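(* Let $Y$ be a Banach space. If for all $n\in\mathbb{N}$, $\ell_\infty^n$ (with its unit vector basis) is in the $n$-th asymptotic structure of $Y$, then $\sup_{k\in\mathbb{N}} c_Y(D_k^\omega)<\infty$, i.e. the sequence $(D_k^\omega)_{k\in\mathbb{N}}$ of countably branching diamond graphs can be equi-bi-Lipschitzly embedded into $Y$.
   Context: Distortion: for metric spaces $(X,d_X)$, $(Y,d_Y)$, $c_Y(X)$ is the infimum of all $D\ge 1$ for which there are $s>0$ and $f\colon X\to Y$ with $s\,d_X(x,y)\le d_Y(f(x),f(y))\le D s\,d_X(x,y)$ for all $x,y\in X$ (and $c_Y(X)=\infty$ if there is none). Countably branching diamond graphs: $D_0^\omega$ is the graph with two vertices joined by an edge. For $k\ge 0$, $D_{k+1}^\omega$ is obtained from $D_k^\omega$ by removing each edge $\{u,v\}$ and adding instead a countably infinite set of new vertices (disjoint sets for distinct edges), each joined by an edge to $u$ and to $v$ and to nothing else. (So $D_1^\omega=K_{2,\omega}$.) The metric space $D_k^\omega$ is its vertex set with the shortest path metric, edges having length one. Asymptotic structure: $\mathrm{cof}(Y)$ denotes the set of (closed) finite-codimensional subspaces of $Y$, and $S_Z$ the unit sphere of $Z$. Sequences $(x_j)_{j=1}^n$, $(e_j)_{j=1}^n$ are $K$-equivalent if there are $a,b>0$ with $ab\le K$ and $\frac1a\|\sum \alpha_j e_j\|\le\|\sum \alpha_j x_j\|\le b\|\sum \alpha_j e_j\|$ for all scalars $\alpha_j$. An $n$-dimensional Banach space $E$ with normalized basis $(e_j)_{j=1}^n$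 is in the $n$-th asymptotic structure of $Y$ if for all $\varepsilon>0$: $\forall Y_1\in\mathrm{cof}(Y)\ \exists x_1\in S_{Y_1}\ \ldots\ \forall Y_n\in\mathrm{cof}(Y)\ \exists x_n\in S_{Y_n}$ such that $(x_j)_{j=1}^n$ is $(1+\varepsilon)$-equivalent to $(e_j)_{j=1}^n$. *)

(* Defs.v *)
From HB Require Import structures.
From mathcomp Require Import all_boot all_order all_algebra.
From mathcomp Require Import all_classical all_reals all_analysis.
Import Order.TTheory GRing.Theory Num.Theory.
Import numFieldNormedType.Exports.

Set Implicit Arguments.
Unset Strict Implicit.
Unset Printing Implicit Defensive.

Local Open Scope classical_set_scope.
Local Open Scope ring_scope.

(* [dX] and [dY] are the distance functions of the two metric spaces. The
   infimum is taken in the extended reals, so it is [+oo] when there is no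
   admissible [D]. *)
Definition distortion (R : realType) (X Y : Type)
    (dX : X -> X -> R) (dY : Y -> Y -> R) : \bar R :=
  ereal_inf [set D%:E | D in [set D : R | 1 <= D /\
    exists s : R, 0 < s /\ exists f : X -> Y, forall x y,
      s * dX x y <= dY (f x) (f y) <= D * s * dX x y]].

Record graph := Graph { vertex : Type ; adj : vertex -> vertex -> Prop }.

(* An undirected edge is the set of its two end points. *)
Definition edge (G : graph) : Type :=
  {e : set (vertex G) | exists u v, adj u v /\ e = [set u; v]}.

(* [inr (e, i)] is the [i]-th of the new vertices that replace the edge [e]. *)
Definition diamond_step_adj (G : graph) (x y : vertex G + edge G * nat) : Prop :=
  match x, y with
  | inl u, inr (e, _) | inr (e, _), inl u => sval e u
  | _, _ => False
  end.

Definition diamond_step (G : graph) : graph := Graph (@diamond_step_adj G).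

Definition single_edge : graph := Graph (fun u v : bool => u <> v).

Definition diamond (k : nat) : graph := iter k diamond_step single_edge.

Definition walk (G : graph) (n : nat) (u v : vertex G) : Prop :=
  exists p : nat -> vertex G,
    [/\ p 0%N = u, p n = v & forall i, (i < n)%N -> adj (p i) (p i.+1)].

(* The shortest path metric of a connected graph; all the graphs [diamond k]
   are connected. *)
Definition graph_dist (R : realType) (G : graph) (u v : vertex G) : R :=
  inf [set n%:R | n in [set n : nat | walk n u v]].

Arguments graph_dist R G u v : clear implicits.

Section asymptotic_structure.
Variable K : numFieldType.

(* When [K] is the field of complex numbers, [0 < a] entails that [a] is real,
   so that the constants below are positive real numbers in all cases. *)
Definition equivalent_families (C : K) (E F : normedModType K) (n : nat)
    (x : 'I_n -> F) (e : 'I_n -> E) : Prop :=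
  exists a b : K, [/\ 0 < a, 0 < b, a * b <= C &
    forall alpha : 'I_n -> K,
      a^-1 * `|\sum_(j < n) alpha j *: e j| <= `|\sum_(j < n) alpha j *: x j|
        <= b * `|\sum_(j < n) alpha j *: e j|].

(* The codimension of [Z] is finite when the classes modulo [Z] of finitely
   many vectors span the quotient of [Y] by [Z]. *)
Definition cof (Y : normedModType K) (Z : {pred Y}) : Prop :=
  [/\ submod_closed Z, closed [set` Z] &
    exists (m : nat) (b : 'I_m -> Y), forall y : Y,
      exists c : 'I_m -> K, y - \sum_(i < m) c i *: b i \in Z].

(* forall Y_1 in cof(Y), exists x_1 in the unit sphere of Y_1, ...,
   forall Y_n in cof(Y), exists x_n in the unit sphere of Y_n,
   P (x_1, ..., x_n) *)
Fixpoint cof_game (Y : normedModType K) (n : nat) :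
    (n.-tuple Y -> Prop) -> Prop :=
  match n with
  | 0 => fun P => P [tuple]
  | m.+1 => fun P => forall Z : {pred Y}, cof Z ->
      exists2 x : Y, x \in Z /\ `|x| = 1 &
        cof_game (fun t : m.-tuple Y => P [tuple of x :: t])
  end.

(* The space [E] with its normalized basis [e] is in the [n]-th asymptotic
   structure of [Y]. *)
Definition asymptotic_structure (Y E : normedModType K) (n : nat)
    (e : 'I_n -> E) : Prop :=
  forall eps : K, 0 < eps ->
    cof_game (fun t : n.-tuple Y => equivalent_families (1 + eps) (tnth t) e).

(* The norm of ['rV[K]_n] is the maximum of the absolute values of the entries,
   i.e., ['rV[K]_n] is l_oo^n. *)
Definition linf_basis (n : nat) (j : 'I_n) : 'rV[K]_n := delta_mx 0 j.

End asymptotic_structure.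

(* Main.v *)
(* The points of the diamond graphs are mapped to sums along a tree of vectors.
   Call the sequences (i_1, ..., i_t) of natural numbers nodes.  Playing the
   asymptotic structure game along every branch of the tree of nodes, and choosing
   each subspace as the common kernel of norming functionals of all the vectors
   chosen before (for an enumeration in which ancestors come first), gives vectors
   X_s such that X_s is normed by a functional that kills all later vectors, while
   every sum of +X_s and -X_s along a branch has norm at most 2.

   The embedding is f(0) = 0, f(1) = X_root on the single edge; when an edge {u, v}
   with address s is replaced by the points ({u, v}, i), the old points get 2 f(u),
   2 f(v) and the new ones get f(u) + f(v) + X_(s, i).  Differences of f along edges
   are then signed sums along branches, so that f is 2-Lipschitz.  For the lower
   estimate follow x and y down to the last edge {u, v} whose copy contains both,
   and let M be the rescaled length of its halves: f(x) is
   (f(u) + f(v)) M +- (f(u) - f(v)) b + X_(s, i) a + (later vectors), where a and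
   b = M - a are the distances of x to an end point of {u, v} and to the new
   point ({u, v}, i).  The root coefficient of f(x) - f(y) bounds the difference
   of heights.  Once the signed sum has been subtracted, the first of the nodes
   (s, i), (s, j) bounds the smaller of the distances to {u, v}; together they bound
   d(x, y) by 7 |f(x) - f(y)|. *)
Require Import Defs.
From HB Require Import structures.
From mathcomp Require Import all_boot all_order all_algebra.
From mathcomp Require Import all_classical all_reals all_analysis.
From mathcomp Require Import complex lra ring zify.
Import Order.TTheory GRing.Theory Num.Theory.
Import numFieldNormedType.Exports.

Set Implicit Arguments.
Unset Strict Implicit.
Unset Printing Implicit Defensive.

Local Open Scope classical_set_scope.
Local Open Scope ring_scope.

(** * Nodes and their codes *)

(* Nodes are stored with the latest choice first, so that ancestors are suffixes
   and have a smaller code. *)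
Lemma code_cons i s : (CodeSeq.code s < CodeSeq.code (i :: s))%N.
Proof.
rewrite /=; have : (0 < 2 ^ i)%N by rewrite expn_gt0.
by move: (2 ^ i)%N (CodeSeq.code s) => a b ha; nia.
Qed.

Lemma code_cat r s : (CodeSeq.code s <= CodeSeq.code (r ++ s))%N.
Proof.
by elim: r => [//|i r IH]; apply: leq_trans IH (ltnW (code_cons _ _)).
Qed.

Lemma code_nil_lt i s : (CodeSeq.code [::] < CodeSeq.code (i :: s))%N.
Proof. by apply: leq_ltn_trans (code_cons i s). Qed.

(** * Edges, iterated subdivisions and walks *)

Lemma set2_inj (T : Type) (u v p q : T) :
  [set u; v] = [set p; q] -> (u = p /\ v = q) \/ (u = q /\ v = p).
Proof.
move=> h.
have hu : [set p; q] u by rewrite -h; left.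
have hv : [set p; q] v by rewrite -h; right.
have hp : [set u; v] p by rewrite h; left.
have hq : [set u; v] q by rewrite h; right.
case: hu => /= hu; case: hv => /= hv; case: hp => /= hp; case: hq => /= hq;
  subst; by [left|right|left; split|right; split].
Qed.

Lemma edge_eq (G : graph) (e e' : edge G) : sval e = sval e' -> e = e'.
Proof. by case: e => [e he]; case: e' => [e' he'] /= h; exact: eq_exist. Qed.

(* [diamond] adds its finest subdivision last; here the first subdivision of [G] is
   peeled off instead, which allows inductions that start from the coarsest graph. *)
Fixpoint refine (m : nat) (G : graph) : graph :=
  if m is m'.+1 then refine m' (diamond_step G) else G.

Lemma diamond_refine k : diamond k = refine k single_edge.
Proof.
rewrite /diamond; move: single_edge.
by elim: k => [//|k IH] G; rewrite iterSr IH.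
Qed.

Fixpoint inc (m : nat) (G : graph) : vertex G -> vertex (refine m G) :=
  match m with
  | 0 => id
  | m'.+1 => fun u => @inc m' (diamond_step G) (inl u)
  end.

Lemma walk0 (G : graph) (u : vertex G) : walk 0 u u.
Proof. by exists (fun=> u). Qed.

Lemma walk1 (G : graph) (u v : vertex G) : adj u v -> walk 1 u v.
Proof.
by move=> uv; exists (fun i => if i is 0%N then u else v); split => // -[].
Qed.

Lemma walk_cat (G : graph) a b (u v w : vertex G) :
  walk a u v -> walk b v w -> walk (a + b) u w.
Proof.
move=> [p [p0 pa hp]] [q [q0 qb hq]].
exists (fun i => if (i <= a)%N then p i else q (i - a)%N); split => //.
- case: leqP => [|_]; last by rewrite addKn.
  by rewrite -{2}[a]addn0 leq_add2l leqn0 => /eqP b0; subst b; rewrite addn0 pa -q0.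
- move=> i hi; case: (ltngtP i a) => [ia|ia|ia].
  + exact: hp.
  + by rewrite subSn 1?ltnW//; apply: hq; lia.
  + subst i; rewrite subSnn pa -q0; apply: hq; lia.
Qed.

Lemma walk_sym (G : graph) n (u v : vertex G) :
  (forall x y : vertex G, adj x y -> adj y x) -> walk n u v -> walk n v u.
Proof.
move=> sG [p [p0 pn hp]]; exists (fun i => p (n - i)%N); split.
- by rewrite subn0.
- by rewrite subnn.
- move=> i hi; apply: sG; rewrite -[(n - i)%N]subnSK //; apply: hp; lia.
Qed.

Lemma refine_sym m (G : graph) :
  (forall x y : vertex G, adj x y -> adj y x) ->
  forall x y : vertex (refine m G), adj x y -> adj y x.
Proof.
elim: m G => [//|m IH] G sG /=; apply: IH.
by move=> [x|[e i]] [y|[e' j]].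
Qed.

Definition mk_edge (G : graph) (u v : vertex G) (uv : adj u v) : edge G :=
  exist _ [set u; v] (ex_intro _ u (ex_intro _ v (conj uv erefl))).

Lemma edge_ends (G : graph) (e : edge G) :
  exists uv : vertex G * vertex G, sval e = [set uv.1; uv.2].
Proof. by case: e => e [u [v [uv he]]] /=; exists (u, v). Qed.

(** Edges are unordered, so an order of the end points is chosen; [step_inr] shows that the
    embedding does not depend on it. *)
Definition ends (G : graph) (e : edge G) := projT1 (cid (edge_ends e)).

Lemma endsE (G : graph) (e : edge G) : sval e = [set (ends e).1; (ends e).2].
Proof. exact: (projT2 (cid (edge_ends e))). Qed.

Lemma step_edge (G : graph) (E : edge (diamond_step G)) :
  exists ei : edge G * nat, exists2 w, sval ei.1 w &
    sval E = [set inl w; inr ei].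
Proof.
case: E => E [[u|[e i]] [[v|[e' j]] [/= h hE]]] //.
- by exists (e', j), u.
- by exists (e, i), v; rewrite // hE setUC.
Qed.

(** Each edge of the subdivision has one new end point, which records the parent edge and an
    index. *)
Definition mid (G : graph) (E : edge (diamond_step G)) := projT1 (cid (step_edge E)).

Lemma midE (G : graph) (E : edge (diamond_step G)) :
  exists2 w, sval (mid E).1 w & sval E = [set inl w; inr (mid E)].
Proof. exact: (projT2 (cid (step_edge E))). Qed.

Lemma edge_other (G : graph) (e : edge G) w : sval e w ->
  exists v, sval e = [set w; v].
Proof.
rewrite {1}endsE endsE => -[/= ->|/= ->]; first by exists (ends e).2.
by exists (ends e).1; rewrite setUC.
Qed.

(** The walk passes through the new vertex of index 0, so each subdivision doubles its length. *)
Lemma walk_inc m (G : graph) (u v : vertex G) :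
  adj u v -> walk (2 ^ m) (inc m u) (inc m v).
Proof.
elim: m G u v => [|m IH] G u v uv; first exact: walk1.
rewrite expnS mul2n -addnn /=.
by apply: (@walk_cat _ _ _ _ (inc m (inr (mk_edge uv, 0%N) : vertex (diamond_step G))));
  apply: IH => /=; [left|right].
Qed.

Lemma edge_walk m (G : graph) (e : edge G) (u v : vertex G) :
  (forall x y : vertex G, adj x y -> adj y x) -> sval e = [set u; v] ->
  walk (2 ^ m) (inc m u) (inc m v).
Proof.
move=> sG; case: e => e [p [q [pq he]]] /= h; apply: walk_inc.
by rewrite he in h; case: (set2_inj h) => -[<- <-] //; exact: sG.
Qed.

(* [x] lies in the copy of [refine m single_edge] that replaces [e]. *)
Fixpoint inside (m : nat) (G : graph) : edge G -> vertex (refine m G) -> Prop :=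
  match m with
  | 0 => fun e x => sval e x
  | m'.+1 => fun e x => exists E : edge (diamond_step G),
      (mid E).1 = e /\ @inside m' (diamond_step G) E x
  end.

Lemma inside_cover m (G : graph) : (forall u : vertex G, exists e : edge G, sval e u) ->
  forall x : vertex (refine m G), exists e : edge G, inside e x.
Proof.
elim: m G => [//|m IH] G cG x.
have [|E hE] := IH (diamond_step G) _ x; last by exists (mid E).1, E.
have step_cover (e : edge G) (w : vertex G) i : sval e w ->
    exists E : edge (diamond_step G), sval E = [set inl w; inr (e, i)].
  by move=> ew; exists (@mk_edge (diamond_step G) (inl w) (inr (e, i)) ew).
case=> [u|[e i]].
- have [e eu] := cG u; have [E hE] := step_cover e u 0%N eu.
  by exists E; rewrite hE; left.
- have e1 : sval e (ends e).1 by rewrite endsE; left.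
  have [E hE] := step_cover e (ends e).1 i e1.
  by exists E; rewrite hE; right.
Qed.

(** * Signed sums along branches *)

Section signed_sums.
Variables (Y : zmodType) (X : seq nat -> Y).

Fixpoint signed_sum (s : seq nat) : set Y :=
  if s is i :: s' then [set w | exists2 w', signed_sum s' w' &
                          w = w' + X s \/ w = w' - X s]
  else [set w | w = X [::] \/ w = - X [::]].

Lemma signed_sumN s w : signed_sum s w -> signed_sum s (- w).
Proof.
elim: s w => [|i s IH] w /=; first by case=> ->; rewrite ?opprK; [right|left].
move=> [w' /IH hw' h]; exists (- w') => //.
by case: h => ->; rewrite opprD ?opprK; [right|left].
Qed.

End signed_sums.

(** * The embedding, for an abelian group with a norm-like function *)

Section embedding.
(** Homogeneity is stated for natural multiples only, which serves real and complex scalars alike.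
    [Z s] stands for the kernel of a functional norming [X s]. *)
Variables (R : realType) (Y : zmodType) (N : Y -> R).
Hypothesis N0 : N 0 = 0.
Hypothesis ND : forall x y, N (x + y) <= N x + N y.
Hypothesis NN : forall x, N (- x) = N x.
Hypothesis NM : forall x n, N (x *+ n) = N x *+ n.

Variables (X : seq nat -> Y) (Z : seq nat -> set Y) (k : nat).
Hypothesis Z0 : forall s, Z s 0.
Hypothesis ZB : forall s x y, Z s x -> Z s y -> Z s (x - y).
Hypothesis ZX : forall s s', (CodeSeq.code s < CodeSeq.code s')%N -> Z s (X s').
Hypothesis NZ : forall s n z, (size s <= k)%N -> Z s z -> n%:R <= N (X s *+ n + z).
Hypothesis Nss : forall s w, (size s <= k)%N -> signed_sum X s w -> N w <= 2.

Let ZN s x : Z s x -> Z s (- x).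
Proof. by move=> h; rewrite -sub0r; exact: ZB. Qed.

Let ZD s x y : Z s x -> Z s y -> Z s (x + y).
Proof. by move=> hx hy; rewrite -[y]opprK; apply: ZB => //; exact: ZN. Qed.

Let ZMn s x n : Z s x -> Z s (x *+ n).
Proof. by move=> hx; elim: n => [|n IH]; rewrite ?mulr0n// mulrS; exact: ZD. Qed.

Lemma signed_sum_root s w : signed_sum X s w ->
  exists z, Z [::] z /\ (w = X [::] + z \/ w = - X [::] + z).
Proof.
elim: s w => [|i s IH] w /=.
  move=> h; exists 0; split=> //.
  by case: h => ->; [left|right]; rewrite addr0.
move=> [w' /IH[z [Zz hz]] h].
exists (w - w' + z); split.
  have ZXs := ZX (code_nil_lt i s).
  by apply: ZD => //; case: h => ->; rewrite addrAC subrr add0r //; exact: ZN.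
by case: hz => hz; [left|right]; rewrite addrCA -hz subrK.
Qed.

Lemma signed_sum_ge s w c z : signed_sum X s w -> Z [::] z ->
  c%:R <= N (w *+ c + z).
Proof.
move=> /signed_sum_root[z' [Zz' h]] Zz; case: h => ->.
- by rewrite mulrnDl -addrA; apply: NZ => //; apply: ZD => //; exact: ZMn.
- rewrite -NN opprD mulrnDl opprD mulNrn opprK -addrA; apply: NZ => //.
  by apply: ZD; apply: ZN => //; exact: ZMn.
Qed.

(** [belowS s] is the subgroup generated by the vectors at strict descendants of [s], as the
    intersection of all [T] with [below s T]. *)
Definition below (s : seq nat) (T : set Y) :=
  [/\ T 0, forall x y, T x -> T y -> T (x - y) & forall r i, T (X (r ++ i :: s))].

Definition belowS s z := forall T, below s T -> T z.

Lemma belowS0 s : belowS s 0.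
Proof. by move=> T []. Qed.

Lemma below_Z s t : (CodeSeq.code t <= CodeSeq.code s)%N -> below s (Z t).
Proof.
move=> ts; split => // [x y|r i]; first exact: ZB.
by apply: ZX; apply: leq_ltn_trans ts _; apply: leq_trans (code_cons i s) (code_cat _ _).
Qed.

Lemma belowS_step s i a z : belowS (i :: s) z -> belowS s (X (i :: s) *+ a + z).
Proof.
move=> h T [T0 TB TX].
have TN x : T x -> T (- x) by move=> hx; rewrite -sub0r; exact: TB.
have TD x y : T x -> T y -> T (x + y).
  by move=> hx hy; rewrite -[y]opprK; apply: TB => //; exact: TN.
apply: (TD).
  elim: a => [|a IH]; rewrite ?mulr0n// mulrS; apply: (TD) => //; exact: (TX [::]).
by apply: h; split => // r j; rewrite -cat_rcons; apply: TX.
Qed.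

(* The functional of the node with the smaller code kills all other terms. *)
Lemma branching_ge s i j a b z z' : (size s < k)%N -> i <> j ->
  belowS (i :: s) z -> belowS (j :: s) z' ->
  (minn a b)%:R <= N (X (i :: s) *+ a + z - (X (j :: s) *+ b + z')).
Proof.
wlog ij : i j a b z z' / (CodeSeq.code (i :: s) <= CodeSeq.code (j :: s))%N =>
  [H|] sk nij hz hz'.
  case/orP: (leq_total (CodeSeq.code (i :: s)) (CodeSeq.code (j :: s))) => h.
    exact: H.
  rewrite -NN opprB minnC; apply: H => //; exact: nesym.
have {}ij : (CodeSeq.code (i :: s) < CodeSeq.code (j :: s))%N.
  rewrite ltn_neqAle ij andbT; apply/eqP => /(can_inj CodeSeq.codeK) [ //].
rewrite -addrA; apply: le_trans (NZ (s := i :: s) _ sk _).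
  by rewrite ler_nat geq_minl.
apply: ZB; first by apply: hz; exact: below_Z.
apply: ZD; first by apply/ZMn/ZX.
by apply: hz'; apply: below_Z; exact: ltnW.
Qed.

(** Let [S] be the whole sum and [T] its part after [w *+ c]. The root gives [c <= N S], and
    [N w <= 2] gives [minn a b <= N T <= N S + 2 * c <= 3 * N S]; hence the factor 7 = 1 + 2 * 3. *)
Lemma diverging_ge s w c i j a b z z' : (size s < k)%N -> signed_sum X s w ->
  i <> j -> belowS (i :: s) z -> belowS (j :: s) z' ->
  (c + (minn a b).*2)%:R <=
    7 * N (w *+ c + (X (i :: s) *+ a + z - (X (j :: s) *+ b + z'))).
Proof.
move=> sk hw ij hz hz'; set T := _ - _.
have hT : Z [::] T.
  have h l : below (l :: s) (Z [::]).
    by apply: below_Z; apply/ltnW/code_nil_lt.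
  apply: ZB; apply: ZD; [|by apply: hz; exact: h| |by apply: hz'; exact: h];
    by apply/ZMn/ZX/code_nil_lt.
have h1 := signed_sum_ge c hw hT.
have h2 : (minn a b)%:R <= N T by exact: branching_ge.
have h3 : N T <= N (w *+ c + T) + N (w *+ c).
  by rewrite -{1}[T](addKr (w *+ c)) addrC -[N (w *+ c)]NN; exact: ND.
have h4 : N (w *+ c) <= 2 * c%:R.
  by rewrite NM -[_ *+ c]mulr_natr; apply: ler_wpM2r => //; exact: Nss (ltnW sk) hw.
rewrite natrD -muln2 natrM; lra.
Qed.

(** * Extension of a map to the refinements *)

Definition step (G : graph) (f : vertex G -> Y) (ad : edge G -> seq nat)
    (x : vertex (diamond_step G)) : Y :=
  match x with
  | inl u => f u *+ 2
  | inr (e, i) => f (ends e).1 + f (ends e).2 + X (i :: ad e)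
  end.

(** The two halves that meet at a new vertex share one address. *)
Definition step_addr (G : graph) (ad : edge G -> seq nat)
    (E : edge (diamond_step G)) : seq nat := (mid E).2 :: ad (mid E).1.

Fixpoint extend (m : nat) (G : graph) : (vertex G -> Y) -> (edge G -> seq nat) ->
    vertex (refine m G) -> Y :=
  match m with
  | 0 => fun f _ => f
  | m'.+1 => fun f ad => @extend m' (diamond_step G) (step f ad) (step_addr ad)
  end.

Lemma step_inr (G : graph) (f : vertex G -> Y) ad (e : edge G) i u v :
  sval e = [set u; v] -> step f ad (inr (e, i)) = f u + f v + X (i :: ad e).
Proof.
rewrite endsE => he; case: (set2_inj he) => -[<- <-] //=.
by congr (_ + _); rewrite addrC.
Qed.

Lemma recenter (p q : Y) a b :
  p *+ 2 *+ b + (p + q) *+ a = (p + q) *+ (a + b) + (p - q) *+ b.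
Proof.
rewrite mulrnDr -addrA -mulrnDl addrACA subrr addr0 -mulr2n.
by rewrite addrC.
Qed.

Lemma subr_common (p q r q' r' : Y) : p + q + r - (p + q' + r') = q - q' + (r - r').
Proof.
by rewrite opprD addrACA; congr (_ + _); rewrite opprD addrACA subrr add0r.
Qed.

(** Up to vectors below the address, the extension interpolates between the two ends. In the
    induction [x] lies in a half from an old end to the new vertex, and the other old end is [2 ^ m]
    steps further. *)
Lemma inside_expand m (G : graph) (f : vertex G -> Y) ad (e : edge G) u v x :
  (forall x y : vertex G, adj x y -> adj y x) ->
  sval e = [set u; v] -> inside e x ->
  exists a b z, [/\ (a + b = 2 ^ m)%N, walk a (inc m u) x, walk b x (inc m v),
    belowS (ad e) z & extend f ad x = f u *+ b + f v *+ a + z].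
Proof.
elim: m G f ad e u v x => [|m IH] G f ad e u v x sG he /=.
  rewrite he => -[|] /= ->.
  - exists 0%N, 1%N, 0; split=> //; [exact: walk0| |exact: belowS0|].
      by apply: (@edge_walk 0 _ e).
    by rewrite mulr0n !addr0.
  - exists 1%N, 0%N, 0; split=> //; [|exact: walk0|exact: belowS0|].
      by apply: (@edge_walk 0 _ e).
    by rewrite mulr0n add0r addr0.
move=> [E [Ee hx]].
have sG' := @refine_sym 1 G sG.
have [w ew EE] := midE E.
have sR := @refine_sym m.+1 G sG.
(* Here the half containing [x] touches [u']; the other case swaps [a] and [b]. *)
have halves u' v' : sval e = [set u'; v'] -> sval E = [set inl u'; inr (mid E)] ->
    exists a b z, [/\ (a + b = 2 ^ m.+1)%N, walk a (inc m.+1 u') x, walk b x (inc m.+1 v'),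
    belowS (ad e) z & extend f ad x = f u' *+ b + f v' *+ a + z].
  move=> he' EE'.
  have [a [b [z [ab wa wb hz fz]]]] := IH _ (step f ad) (step_addr ad) E _ _ x sG' EE' hx.
  exists a, (b + 2 ^ m)%N, (X (step_addr ad E) *+ a + z); split.
  - by rewrite addnA ab expnS mul2n addnn.
  - exact: wa.
  - apply: walk_cat wb _; apply: (walk_sym sR).
    have ev : sval (mid E).1 v' by rewrite Ee he'; right.
    apply: (@walk_inc m (diamond_step G)) => /=.
    by case: (mid E) ev.
  - rewrite -Ee; apply: belowS_step; exact: hz.
  - have this : step f ad (inr (mid E)) = f u' + f v' + X (step_addr ad E).
      rewrite /step_addr; case: (mid E) Ee => e1 i /= Ee.
      by subst e1; rewrite -(step_inr f ad i he').
    rewrite /= fz this /= -mulrnA mulrnDl addrA addrA; congr (_ + _).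
    congr (_ + _); rewrite mulrnDl addrA -mulrnDr; congr (_ *+ _ + _).
    by rewrite -ab; lia.
have ew' : sval e w by rewrite -Ee.
case: (edge_other ew') => w' he'.
have [a [b [z [ab wa wb hz fz]]]] := halves w w' he' EE.
case: (set2_inj (etrans (esym he) he')) => -[-> ->].
  by exists a, b, z.
exists b, a, z; split=> //; [by rewrite addnC|exact: walk_sym wb|exact: walk_sym wa|].
by apply: (etrans fz); congr (_ + _); exact: addrC.
Qed.


(** * Lipschitz bounds for the extension *)

Definition compatible (t : nat) (G : graph) (f : vertex G -> Y) (ad : edge G -> seq nat) :=
  forall (e : edge G) u v, sval e = [set u; v] ->
    size (ad e) = t /\ signed_sum X (ad e) (f u - f v).

(** Seen from an old end [w], the difference is [f v - f w] plus the vector of the new vertex: the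
    old signed sum, negated, with one more term. *)
Lemma compatible_step t (G : graph) (f : vertex G -> Y) ad :
  compatible t f ad -> compatible t.+1 (step f ad) (step_addr ad).
Proof.
move=> hc E p q EE; have [w ew hE] := midE E.
have [v he] := edge_other ew.
have [st hs] := hc _ _ _ he.
split; first by rewrite /step_addr /= st.
suff : signed_sum X (step_addr ad E) (step f ad (inr (mid E)) - step f ad (inl w)).
  move=> h; rewrite hE in EE; case: (set2_inj EE) => -[<- <-] //.
  by rewrite -opprB; exact: signed_sumN.
rewrite /step_addr; case: (mid E) he hs {st ew hE} => e i he hs.
exists (- (f w - f v)); first exact: signed_sumN.
by left; rewrite (step_inr f ad i he) /= opprB mulr2n opprD addrAC addrA
  [f w + f v]addrC addrK.
Qed.

Lemma extend_le m t (G : graph) (f : vertex G -> Y) ad x y :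
  compatible t f ad -> (t + m <= k)%N -> adj x y ->
  N (@extend m G f ad x - extend f ad y) <= 2.
Proof.
elim: m t G f ad x y => [|m IH] t G f ad x y hc tk.
  move=> xy; have [st] := hc (mk_edge xy) x y erefl.
  by apply: Nss; rewrite st -[t]addn0.
by apply: (IH t.+1); [exact: compatible_step|rewrite addSnnS].
Qed.

(** Recentring gives [f w + f v] the coefficient [2 ^ m] in every half of the parent edge, so that
    it cancels in differences. *)
Lemma half_expand m (G : graph) (f : vertex G -> Y) ad
    (E : edge (diamond_step G)) w v x :
  (forall x y : vertex G, adj x y -> adj y x) ->
  sval E = [set inl w; inr (mid E)] -> sval (mid E).1 = [set w; v] ->
  @inside m (diamond_step G) E x ->
  let s := (mid E).2 :: ad (mid E).1 in
  exists a b z, [/\ (a + b = 2 ^ m)%N, walk a (inc m (inl w : vertex (diamond_step G))) x,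
    walk b x (inc m (inr (mid E) : vertex (diamond_step G))), belowS s z &
    @extend m.+1 G f ad x = (f w + f v) *+ 2 ^ m + (f w - f v) *+ b + (X s *+ a + z)].
Proof.
move=> sG EE he hx s.
have sG' := @refine_sym 1 G sG.
have [a [b [z [ab wa wb hz fz]]]] := inside_expand (step f ad) (step_addr ad) sG' EE hx.
exists a, b, z; split=> //.
rewrite /= fz.
have -> : step f ad (inr (mid E)) = f w + f v + X s.
  by rewrite /s; case: (mid E) he => e i /= he; rewrite -(step_inr f ad i he).
by rewrite /= -ab -recenter [(_ + X s) *+ a]mulrnDl !addrA.
Qed.

(** The induction descends while both points lie in the same half. In different halves, an explicit
    walk is compared with the root coefficient and, for distinct new vertices, with
    [diverging_ge]. *)
Lemma extend_ge m t (G : graph) (f : vertex G -> Y) ad (e : edge G) x y :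
  (forall x y : vertex G, adj x y -> adj y x) -> compatible t f ad ->
  (t + m <= k)%N -> inside e x -> inside e y ->
  exists n, walk n x y /\ n%:R <= 7 * N (@extend m G f ad x - extend f ad y).
Proof.
elim: m t G f ad e x y => [|m IH] t G f ad e x y sG hc tk.
  move=> /= ex ey; have [z he] := edge_other ex.
  move: ey; rewrite he => -[|] /= ->.
    by exists 0%N; split; [exact: walk0|rewrite subrr N0 mulr0].
  exists 1%N; split; first by apply: (@edge_walk 0 _ e).
  have [st hs] := hc _ _ _ he.
  have := signed_sum_ge 1 hs (Z0 _); rewrite mulr1n addr0.
  lra.
have sG' := @refine_sym 1 G sG.
have sR := @refine_sym m.+1 G sG.
move=> [E [Ee Ex]] [E' [E'e E'y]].
have [EE'|EE'] := pselect (E = E').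
  move: E'y; rewrite -EE' => E'y.
  apply: (IH t.+1 (diamond_step G) (step f ad) (step_addr ad) E) => //.
    exact: compatible_step.
  by rewrite addSnnS.
have [w ew hE] := midE E; have [w' ew' hE'] := midE E'.
have [v hv] := edge_other ew.
have hv1 : sval e = [set w; v] by rewrite -Ee.
have hv' : sval (mid E').1 = [set w; v] by rewrite E'e -hv1.
have [a [b [z [ab wa wb hz fx]]]] := half_expand f ad sG hE hv Ex.
have [st hs] := hc _ _ _ hv1.
have sk : (size (ad e) < k)%N by rewrite st; lia.
have mE : mid E = (e, (mid E).2) by case: (mid E) Ee => ? ? /= ->.
have mE' : mid E' = (e, (mid E').2) by case: (mid E') E'e => ? ? /= ->.
rewrite Ee /= in hz fx.
have below_root i c z1 : belowS (i :: ad e) z1 -> Z [::] (X (i :: ad e) *+ c + z1).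
  move=> h; apply: ZD; first by apply/ZMn/ZX/code_nil_lt.
  by apply: h; apply: below_Z; apply/ltnW/code_nil_lt.
move: (ew'); rewrite hv' => -[/= w'w|/= w'v].
(* Halves meeting at [w]: since [a + b = a' + b'], the walk through [w] has length
   [a + a' = |b - b'| + 2 * minn a a']. *)
- rewrite w'w in hE'.
  have [a' [b' [z' [ab' wa' wb' hz' fy]]]] := half_expand f ad sG hE' hv' E'y.
  rewrite E'e /= in hz' fy.
  exists (a + a')%N; split; first exact: walk_cat (walk_sym sR wa) wa'.
  have ij : (mid E).2 <> (mid E').2.
    by move=> ij; apply/EE'/edge_eq; rewrite hE hE' mE mE' ij.
  rewrite fx fy subr_common.
  case/orP: (leq_total b' b) => bb.
  + rewrite -mulrnBr//.
    apply: le_trans (diverging_ge (b - b') a a' sk hs ij hz hz'); rewrite ler_nat; lia.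
  + rewrite -opprB -mulrnBr// -mulNrn.
    apply: le_trans (diverging_ge (b' - b) a a' sk (signed_sumN hs) ij hz hz').
    rewrite ler_nat; lia.
(* Halves at opposite ends: the multiples of [f w - f v] add up to [b + b']. *)
- rewrite w'v in hE'; have hv2 : sval (mid E').1 = [set v; w] by rewrite hv' setUC.
  have [a' [b' [z' [ab' wa' wb' hz' fy]]]] := half_expand f ad sG hE' hv2 E'y.
  rewrite E'e /= in hz' fy.
  have -> : @extend m (diamond_step G) (step f ad) (step_addr ad) x -
      extend (step f ad) (step_addr ad) y = (f w - f v) *+ (b + b') +
     (X ((mid E).2 :: ad e) *+ a + z - (X ((mid E').2 :: ad e) *+ a' + z')).
    rewrite fx fy [f v + f w]addrC subr_common.
    by rewrite -mulNrn opprB mulrnDr.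
  have [ij|ij] := pselect ((mid E).2 = (mid E').2).
  (* The walk passes through the common new vertex. *)
  + exists (b + b')%N; split.
      apply: walk_cat wb _; apply: (walk_sym sR).
      by rewrite mE ij -mE'.
    have := signed_sum_ge (b + b') hs (ZB (below_root _ a _ hz) (below_root _ a' _ hz')).
    have : 0 <= (b + b')%:R :> R by [].
    lra.
  (* The walk goes round by [w] or [v], whichever is nearer to its point; as
     [2 ^ m = a + b = a' + b'], its length is [b + b' + 2 * minn a a']. *)
  + have D := diverging_ge (b + b') a a' sk hs ij hz hz'.
    have mid_walk p i : sval e p ->
        walk (2 ^ m) (inc m (inl p : vertex (diamond_step G)))
                     (inc m (inr (e, i) : vertex (diamond_step G))).
      by move=> ep; apply: (@walk_inc m (diamond_step G)).
    case/orP: (leq_total a a') => aa.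
    * exists (a + (2 ^ m + b'))%N; split.
        apply: walk_cat (walk_sym sR wa) _; apply: walk_cat (walk_sym sR wb').
        by rewrite mE'; apply: mid_walk; rewrite -Ee.
      apply: le_trans D; rewrite ler_nat; lia.
    * exists (a' + (2 ^ m + b))%N; split.
        apply: (walk_sym sR).
        apply: walk_cat (walk_sym sR wa') _; apply: walk_cat (walk_sym sR wb).
        by rewrite mE; apply: mid_walk; rewrite hv1; right.
      apply: le_trans D; rewrite ler_nat; lia.
Qed.

Lemma distortion_diamond :
  (distortion (graph_dist R (diamond k)) (fun x y : Y => N (x - y)%R) <= 14%:E)%E.
Proof.
rewrite diamond_refine; set G := single_edge.
pose f (u : vertex G) : Y := if u then X [::] else 0.
pose ad (e : edge G) : seq nat := [::].
have sG (x y : vertex G) : adj x y -> adj y x by move=> /nesym.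
have Gedge (e : edge G) : sval e = [set true; false].
  case: e => e [u [v [uv he]]] /=; rewrite he.
  by case: u v uv {he} => -[] // _; rewrite setUC.
have hc : compatible 0 f ad.
  move=> e u v; rewrite Gedge => h; split=> //.
  by case: (set2_inj h) => -[<- <-] /=; rewrite ?subr0 ?sub0r; [left|right].
pose F := @extend k G f ad.
have near (x y : vertex (refine k G)) :
    exists n, walk n x y /\ n%:R <= 7 * N (F x - F y).
  have cov (u : vertex G) : exists e : edge G, sval e u.
    have tf : adj (true : vertex G) (false : vertex G) by [].
    by exists (mk_edge tf); case: u; [left|right].
  have [e ex] := inside_cover cov x; have [e' ey] := inside_cover cov y.
  have ee : e' = e by apply: edge_eq; rewrite !Gedge.
  by rewrite ee in ey; exact: extend_ge sG hc _ ex ey.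
have far n (x y : vertex (refine k G)) : walk n x y -> N (F x - F y) <= 2 * n%:R.
  elim: n x y => [|n IH] x y [p [px py hp]].
    by rewrite -px -py subrr N0 mulr0.
  rewrite -px -py -(subrKA (F (p n))) -[n.+1%:R]natr1 mulrDr mulr1.
  apply: le_trans (ND _ _) (lerD _ _).
    by apply: IH; exists p; split=> // i ni; apply: hp; exact: ltnW.
  by apply: (extend_le hc) => //; exact: hp.
(* The lower constant is 1/7 and the upper constant 2, with ratio 14. *)
apply: ereal_inf_lbound; exists 14 => //; split; first lra.
exists 7^-1; split; first by rewrite invr_gt0.
exists F => x y; have [n [wn hn]] := near x y.
set S := [set n%:R | n in [set n : nat | walk n x y]] : set R.
have S0 : S !=set0 by exists n%:R, n.
have lS : lbound S 0 by move=> _ [q _ <-].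
apply/andP; split.
- rewrite ler_pdivrMl //; apply: le_trans hn.
  by apply: ge_inf; [exists 0|exists n].
- rewrite (_ : 14 * 7^-1 = 2); last by lra.
  rewrite -ler_pdivrMl //; apply: lb_le_inf => // _ [q /= wq <-].
  by rewrite ler_pdivrMl //; exact: far.
Qed.

End embedding.

(** * Hahn-Banach through minimal sublinear functionals *)

Section hahn_banach.
Variables (R : realType) (K : numFieldType) (iota : {rmorphism R -> K}) (V : lmodType K).

(** Only real scalars, sent to [K] by [iota], enter the homogeneity: complex spaces are treated as
    real ones. *)
Definition sublinear (p : V -> R) :=
  (forall x y, p (x + y) <= p x + p y) /\
  (forall t x, 0 <= t -> p (iota t *: x) = t * p x).

Lemma sublinear0 p : sublinear p -> p 0 = 0.
Proof. by move=> [_ pZ]; have := pZ 0 0 (lexx _); rewrite scaler0 mul0r. Qed.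

Lemma sublinear_opp_ge p z : sublinear p -> - p (- z) <= p z.
Proof.
move=> sp; have [pD _] := sp; have := pD z (- z).
by rewrite subrr sublinear0// -lerBlDr sub0r.
Qed.

Section inf_family.
Variables (I : Type) (A : set I) (F : I -> V -> R) (m : V -> R).
Hypothesis A0 : A !=set0.
Hypothesis mF : forall i z, A i -> m z <= F i z.
Hypothesis F0 : forall i, A i -> F i 0 = 0.
Hypothesis FD : forall i j x y, A i -> A j ->
  exists2 l, A l & F l (x + y) <= F i x + F j y.
Hypothesis FZ : forall i t x, A i -> 0 < t ->
  exists2 j, A j & F j (iota t *: x) <= t * F i x.

(** Serves both the shifts, whose parameters add up in [FD], and the chains of Zorn's lemma, where
    [FD] takes the smaller of two functionals. *)
Definition inf_family z := inf [set F i z | i in A].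

Lemma inf_family_le i z : A i -> inf_family z <= F i z.
Proof.
move=> Ai; apply: ge_inf; last by exists i.
by exists (m z) => _ [j Aj <-]; exact: mF.
Qed.

Lemma le_inf_family c z : (forall i, A i -> c <= F i z) -> c <= inf_family z.
Proof.
move=> h; apply: lb_le_inf; first by have [i Ai] := A0; exists (F i z), i.
by move=> _ [i Ai <-]; exact: h.
Qed.

Lemma inf_family_sublinear : sublinear inf_family.
Proof.
have qZ t x : 0 < t -> inf_family (iota t *: x) <= t * inf_family x.
  move=> t0; rewrite -ler_pdivrMl //; apply: le_inf_family => i Ai.
  rewrite ler_pdivrMl //; have [j Aj hj] := FZ x Ai t0.
  by apply: le_trans hj; exact: inf_family_le.
split=> [x y|t x].
  rewrite -lerBlDr; apply: le_inf_family => i Ai.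
  rewrite lerBlDr [F i x + _]addrC -lerBlDr; apply: le_inf_family => j Aj.
  rewrite lerBlDr; have [l Al hl] := FD y x Aj Ai.
  by rewrite [x + y]addrC; apply: le_trans (inf_family_le _ Al) hl.
rewrite le_eqVlt => /orP[/eqP <-|t0].
  rewrite rmorph0 scale0r mul0r; apply/eqP; rewrite eq_le; apply/andP; split.
    by have [i Ai] := A0; have := inf_family_le 0 Ai; rewrite F0.
  by apply: le_inf_family => i /F0 ->.
apply/eqP; rewrite eq_le qZ //= -ler_pdivlMl //.
apply: le_trans (qZ _ _ _); last by rewrite invr_gt0.
by rewrite scalerA -rmorphM mulVf ?gt_eqF// rmorph1 scale1r.
Qed.

End inf_family.

(* [q z] is the infimum over [t >= 0] of [p (z + t y) - t p y]. *)
Lemma sublinear_shift p y : sublinear p ->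
  exists q, [/\ sublinear q, forall z, q z <= p z & q (- y) <= - p y].
Proof.
move=> sp; have [pD pZ] := sp.
pose A : set R := [set t | 0 <= t].
pose F t z := p (z + iota t *: y) - t * p y.
have mF t z : A t -> - p (- z) <= F t z.
  move=> t0; rewrite /F -(pZ _ _ t0).
  have := pD (z + iota t *: y) (- z); rewrite addrAC subrr add0r; lra.
have A0 : A !=set0 by exists 0; exact: lexx.
exists (inf_family A F); split.
- apply: (inf_family_sublinear A0 mF) => [t t0|t s x z t0 s0|s t x s0 t0].
  + by rewrite /F add0r pZ // subrr.
  + exists (t + s); first exact: addr_ge0.
    rewrite /F rmorphD scalerDl addrACA mulrDl.
    have := pD (x + iota t *: y) (z + iota s *: y); lra.
  + exists (t * s); first by apply: mulr_ge0 => //; exact: ltW.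
    by rewrite /F rmorphM -scalerA -scalerDr (pZ _ _ (ltW t0)) mulrBr mulrA lexx.
- move=> z; have := inf_family_le mF z (lexx 0 : A 0).
  by rewrite /F rmorph0 scale0r addr0 mul0r subr0.
- have := inf_family_le mF (- y) (ler01 : A 1).
  by rewrite /F rmorph1 scale1r addNr (sublinear0 sp) mul1r sub0r.
Qed.

(* A minimal sublinear functional [p] coincides with its shifts, hence is odd. *)
Lemma minimal_sublinear p0 : sublinear p0 ->
  exists p, [/\ sublinear p, forall z, p z <= p0 z & forall y, p (- y) = - p y].
Proof.
move=> sp0.
pose T := {p : V -> R | sublinear p /\ forall z, p z <= p0 z}.
(* The order is reversed, so that a maximal element is a minimal functional. *)
pose le (a b : T) := `[< forall z, sval b z <= sval a z >].
have [|||C Ctot|[p [sp pp0]] pmin] := @Zorn T le.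
- by move=> a; apply/asboolP.
- move=> a b c /asboolP ab /asboolP bc; apply/asboolP => z.
  exact: le_trans (bc z) (ab z).
- move=> [a sa] [b sb] /asboolP /= ab /asboolP /= ba; apply: eq_exist.
  by apply/funext => z; apply/le_anti; rewrite ba ab.
- have [->|/set0P C0] := eqVneq C set0.
    pose q : T := exist _ p0 (conj sp0 (fun z => lexx _)).
    by exists q.
  pose F (a : T) z := sval a z.
  have mF a z : C a -> - p0 (- z) <= F a z.
    case: a => a [sa ap0] _; apply: le_trans (sublinear_opp_ge z sa).
    by rewrite lerN2; exact: ap0.
  have sq : sublinear (inf_family C F).
    apply: (inf_family_sublinear C0 mF) => [a _|a b x y Ca Cb|a t x Ca t0].
    + exact: sublinear0 (proj1 (svalP a)).
    + have [/asboolP ab|/asboolP ba] := Ctot a b Ca Cb; [exists b => //|exists a => //].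
      * apply: le_trans (proj1 (proj1 (svalP b)) x y) _.
        by apply: lerD => //; exact: ab.
      * apply: le_trans (proj1 (proj1 (svalP a)) x y) _.
        by apply: lerD => //; exact: ba.
    + by exists a => //; rewrite /F (proj2 (proj1 (svalP a))) // ltW.
  have qp0 z : inf_family C F z <= p0 z.
    have [a Ca] := C0; apply: le_trans (inf_family_le mF z Ca) _.
    exact: (proj2 (svalP a)).
  pose q : T := exist _ (inf_family C F) (conj sq qp0).
  by exists q => a Ca; apply/asboolP => z; rewrite /q /=; exact: (inf_family_le mF z Ca).
exists p; split=> // y.
have [q [sq qp qy]] := sublinear_shift y sp.
have qp0 z : q z <= p0 z by apply: le_trans (qp z) (pp0 z).
have [pq] := pmin (exist _ q (conj sq qp0)) (introT (asboolP _) qp).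
apply/le_anti/andP; split; first by rewrite -{1}pq.
by have := sublinear_opp_ge (- y) sp; rewrite opprK.
Qed.

(** The shift at [x] gives [u (- x) <= - p x] for every [u] below it. A minimal [u] is odd, hence
    additive, and [u x >= p x] follows. *)
Lemma norming_functional p x : sublinear p ->
  exists u : V -> R, [/\ forall y z, u (y + z) = u y + u z,
    forall t z, u (iota t *: z) = t * u z, forall z, u z <= p z & u x = p x].
Proof.
move=> sp; have [q [sq qp qx]] := sublinear_shift x sp.
have [u [su uq uN]] := minimal_sublinear sq; have [uD uZ] := su.
exists u; split.
- move=> y z; apply/le_anti; rewrite uD /=.
  by have := uD (y + z) (- z); rewrite addrK uN; lra.
- move=> t z; have [t0|/ltW t0] := leP 0 t; first exact: uZ.
  rewrite -[t]opprK rmorphN scaleNr uN uZ ?oppr_ge0//; lra.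
- by move=> z; exact: le_trans (uq z) (qp z).
- apply/le_anti; rewrite (le_trans (uq x) (qp x)) /=.
  by have := le_trans (uq (- x)) qx; rewrite uN lerN2.
Qed.

End hahn_banach.

(** * Recursive choices, branches and strategies *)

Lemma strong_rec (T : Type) (F : seq T -> T) :
  exists X : nat -> T, forall m, X m = F (mkseq X m).
Proof.
pose L m := iter m (fun l => rcons l (F l)) [::].
exists (fun m => F (L m)) => m; congr F.
by elim: m => [//|m IH]; rewrite mkseqS -IH.
Qed.

(** Lists the values from the root down to [s], in the order of play. *)
Fixpoint branch (T : Type) (W : seq nat -> T) (s : seq nat) : seq T :=
  if s is i :: s' then rcons (branch W s') (W s) else [:: W [::]].

Lemma size_branch (T : Type) (W : seq nat -> T) s : size (branch W s) = (size s).+1.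
Proof. by elim: s => //= i s IH; rewrite size_rcons IH. Qed.

Lemma nth_branch (T : Type) d (W : seq nat -> T) s j : (j <= size s)%N ->
  nth d (branch W s) j = W (drop (size s - j) s).
Proof.
elim: s => [|i s IH] /=; first by case: j.
rewrite leq_eqVlt nth_rcons size_branch => /orP[/eqP ->|js].
  by rewrite ltnn eqxx subnn.
by rewrite js subSn//= IH.
Qed.

Lemma take_branch (T : Type) (W : seq nat -> T) s j : (j <= size s)%N ->
  take j.+1 (branch W s) = branch W (drop (size s - j) s).
Proof.
elim: s => [|i s IH]; first by case: j.
rewrite leq_eqVlt => /orP[/eqP ->|js].
  by rewrite subnn drop0 take_oversize// size_branch.
rewrite -[branch W (i :: s)]/(rcons (branch W s) (W (i :: s))) -cats1.
by rewrite takel_cat ?size_branch// IH// subSn.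
Qed.

Lemma eq_branch (T : Type) (W W' : seq nat -> T) s :
  (forall s', (CodeSeq.code s' <= CodeSeq.code s)%N -> W s' = W' s') ->
  branch W s = branch W' s.
Proof.
elim: s => [|i s IH] h /=; first by rewrite h.
rewrite IH ?h// => s' ss'; apply: h; apply: leq_trans ss' _.
exact/ltnW/code_cons.
Qed.

(** Choice turns the alternating quantifiers into one function. Answers depend only on the subspaces
    played so far, so branches share the vectors of their common initial part. *)
Lemma cof_game_strategy (K : numFieldType) (Y : normedModType K) n
    (P : n.-tuple Y -> Prop) :
  cof_game P -> exists sigma : seq {pred Y} -> Y, forall Zs : seq {pred Y},
    size Zs = n -> (forall i, (i < n)%N -> cof (nth (xpred0 : {pred Y}) Zs i)) ->
    exists2 t : n.-tuple Y, P t & forall i, (i < n)%N ->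
      [/\ nth 0 t i = sigma (take i.+1 Zs), nth 0 t i \in nth (xpred0 : {pred Y}) Zs i
        & `|nth 0 t i| = 1].
Proof.
elim: n P => [|n IH] P; first by exists (fun=> 0) => Zs _ _; exists [tuple].
move=> /= game.
have /choice[phi hphi] : forall Z : {pred Y}, exists xs : Y * (seq {pred Y} -> Y),
    cof Z -> [/\ xs.1 \in Z, `|xs.1| = 1 & forall Zs : seq {pred Y},
    size Zs = n -> (forall i, (i < n)%N -> cof (nth (xpred0 : {pred Y}) Zs i)) ->
    exists2 t : n.-tuple Y, P [tuple of xs.1 :: t] & forall i, (i < n)%N ->
      [/\ nth 0 t i = xs.2 (take i.+1 Zs), nth 0 t i \in nth (xpred0 : {pred Y}) Zs i
        & `|nth 0 t i| = 1]].
  move=> Z; have [cZ|ncZ] := pselect (cof Z); last by exists (0, fun=> 0).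
  have [x [xZ x1] /IH[sigma hs]] := game Z cZ.
  by exists (x, sigma).
exists (fun Zs => if Zs is Z :: Zs' then
  if Zs' is [::] then (phi Z).1 else (phi Z).2 Zs' else 0).
move=> [//|Z Zs] [sZ] cZ.
have [xZ x1 h] := hphi Z (cZ 0%N isT).
have [|t Pt ht] := h Zs sZ; first by move=> i; exact: cZ i.+1.
exists [tuple of (phi Z).1 :: t] => // -[_|i ni] /=; first by rewrite take0.
have [t1 t2 t3] := ht i ni; split=> //.
by rewrite t1; case: Zs sZ {cZ h ht t1 t2} ni => // <-.
Qed.

(** * The tree of vectors *)

Section tree.
Variables (R : realType) (K : numFieldType) (iota : {rmorphism R -> K}) (rho : K -> R).
Hypothesis rhoK : forall c, 0 <= c -> iota (rho c) = c.
Hypothesis ler_iota : {mono iota : x y / x <= y}.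
Variable Y : normedModType K.

(** [rho] inverts [iota] on nonnegative scalars: it is the identity for real scalars and the real
    part for complex ones. *)
Definition rnorm (y : Y) : R := rho `|y|.

Local Notation N := rnorm.

Let iotaN (y : Y) : iota (N y) = `|y|. Proof. exact: rhoK. Qed.

Let iota_inj : injective iota.
Proof. by move=> x y xy; apply/le_anti; rewrite -!ler_iota xy lexx. Qed.

Let N0 : N 0 = 0.
Proof. by apply: iota_inj; rewrite iotaN normr0 rmorph0. Qed.

Let ND x y : N (x + y) <= N x + N y.
Proof. by rewrite -ler_iota rmorphD !iotaN; exact: ler_normD. Qed.

Let NN x : N (- x) = N x.
Proof. by rewrite /rnorm normrN. Qed.

Let NM x n : N (x *+ n) = N x *+ n.
Proof. by apply: iota_inj; rewrite rmorphMn !iotaN normrMn. Qed.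

Lemma norm_sublinear : sublinear iota N.
Proof.
split=> // t x t0; apply: iota_inj.
by rewrite rmorphM !iotaN normrZ ger0_norm// -(rmorph0 iota) ler_iota.
Qed.

(** Linearity and boundedness make the kernel of [g] a member of [cof]; the last clause comes from a
    real functional dominated by [N] with value [N x] at [x]. *)
Definition norming (x : Y) (g : Y -> K) :=
  [/\ forall c y z, g (c *: y + z) = c * g y + g z,
      exists2 C, 0 < C & forall y, `|g y| <= C * `|y| &
      forall n z, g z = 0 -> N x *+ n <= N (x *+ n + z)].

Hypothesis ex_norming : forall x, exists g, norming x g.

Lemma cof_setT : cof (predT : {pred Y}).
Proof.
split=> //; exists 0%N, (fun=> 0) => y; by exists (fun=> 0).
Qed.

(** The codimension grows by at most one: a vector [z0] of [Z] with [g z0 != 0] corrects the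
    remainder modulo [Z]. *)
Lemma cof_kernel (Z : {pred Y}) x g : norming x g -> cof Z ->
  cof (fun y => (g y == 0) && (y \in Z)).
Proof.
move=> [gL [C C0 gC] _] [[Z0 ZL] Zc [m [b hb]]].
have g0 : g 0 = 0 by have := gL (-1) 0 0; rewrite scaler0 addr0 mulN1r addNr.
have gB y z : g (y - z) = g y - g z.
  by rewrite addrC -scaleN1r gL mulN1r addrC.
split.
- split=> [|c y z]; first by rewrite unfold_in /= g0 eqxx.
  rewrite !unfold_in /= => /andP[/eqP gy Zy] /andP[/eqP gz Zz].
  by rewrite gL gy gz mulr0 addr0 eqxx /=; exact: ZL.
- have -> : [set` (fun y => (g y == 0) && (y \in Z)) : {pred Y}] =
      [set y | g y = 0] `&` [set` Z].
    apply/seteqP; split=> y /=; rewrite /in_mem /=.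
      by move=> /andP[/eqP].
    by move=> [-> ?]; rewrite eqxx.
  apply: closedI => // y hy; apply/eqP/negPn/negP => gy.
  (* Within this distance of [y], the functional [g] cannot vanish. *)
  have e0 : 0 < `|g y| / C by rewrite divr_gt0// normr_gt0.
  have [z [/= gz yz]] := hy _ (nbhsx_ballx y _ e0).
  move: yz; rewrite -ball_normE /= ltr_pdivlMr// mulrC => /(le_lt_trans (gC _)).
  by rewrite gB gz subr0 ltxx.
- have [gZ|/existsNP[z0 /not_implyP[Zz0 gz0]]] := pselect (forall z, z \in Z -> g z = 0).
    exists m, b => y; have [c hc] := hb y; exists c.
    by rewrite unfold_in /= gZ// eqxx.
  exists m.+1, (fun i => if unlift ord_max i is Some j then b j else z0) => y.
  have [c hc] := hb y; set w := y - _ in hc.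
  exists (fun i => if unlift ord_max i is Some j then c j else g w / g z0).
  have -> : y - \sum_(i < m.+1)
      (if unlift ord_max i is Some j then c j else g w / g z0) *:
      (if unlift ord_max i is Some j then b j else z0) = - (g w / g z0) *: z0 + w.
    rewrite big_ord_recr /= unlift_none opprD addrA scaleNr addrC; congr (_ + _).
    congr (_ - _); apply: eq_bigr => i _.
    have -> : widen_ord (leqnSn m) i = lift ord_max i.
      by apply/val_inj => /=; rewrite /bump leqNgt ltn_ord.
    by rewrite liftK.
  rewrite unfold_in /= gL mulNr divfK ?addNr ?eqxx /=; last exact/eqP.
  exact: ZL.
Qed.

Lemma signed_sum_coef (X : seq nat -> Y) s w : signed_sum X s w ->
  exists2 alpha : nat -> K, (forall j, `|alpha j| <= 1) &
    w = \sum_(j < (size s).+1) alpha j *: X (drop (size s - j) s).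
Proof.
elim: s w => [|i s IH] w /=.
  move=> h; exists (fun=> if `[< w = X [::] >] then 1 else -1).
    by move=> _; case: ifP; rewrite ?normrN normr1.
  rewrite big_ord1 /=; case: asboolP => [->|nw]; first by rewrite scale1r.
  by rewrite scaleN1r; case: h.
move=> [w' /IH[alpha a1 ->] h].
exists (fun j => if j == (size s).+1 then
    if `[< w = (\sum_(j < (size s).+1) alpha j *: X (drop (size s - j) s)) + X (i :: s) >]
    then 1 else -1 else alpha j).
  by move=> j; case: ifP => // _; case: ifP; rewrite ?normrN normr1.
rewrite big_ord_recr /= eqxx subnn.
rewrite (eq_bigr (fun j : 'I_(size s).+1 => alpha j *: X (drop (size s - j) s))).
  case: asboolP => [{1}->|nw]; first by rewrite scale1r.
  by rewrite scaleN1r; case: h.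
by move=> j _; rewrite ltn_eqF ?ltnS ?leq_ord// subSn ?leq_ord.
Qed.

Lemma linf_norm_le1 n (alpha : 'I_n -> K) : (forall j, `|alpha j| <= 1) ->
  `|\sum_(j < n) alpha j *: linf_basis K j| <= 1.
Proof.
move=> a1; have -> : \sum_(j < n) alpha j *: linf_basis K j = \row_j alpha j.
  rewrite [RHS]row_sum_delta; apply: eq_bigr => j _; by rewrite mxE.
have [->|/mx_norm_neq0[ij E]] := eqVneq (`|\row_j alpha j|) 0; first exact: ler01.
by rewrite [leLHS]E mxE.
Qed.

Lemma linf_basis_norm n (j : 'I_n) : `|linf_basis K j| = 1.
Proof.
have : `|linf_basis K j| != 0.
  rewrite normr_eq0; apply/eqP => /rowP/(_ j); rewrite !mxE !eqxx => /eqP.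
  by rewrite oner_eq0.
move=> h; have [ij E] := mx_norm_neq0 h; rewrite [LHS]E.
have : mx_norm (linf_basis K j) != 0 by [].
rewrite E mxE.
by case: (_ && _); rewrite ?normr1 ?normr0 ?eqxx.
Qed.

Hypothesis Yasym : forall n, asymptotic_structure Y (@linf_basis K n).

Lemma distortion_diamond_le k :
  (distortion (graph_dist R (diamond k)) (fun x y : Y => N (x - y)%R) <= 14%:E)%E.
Proof.
have [g hg] := choice ex_norming.
pose ker (l : seq Y) : {pred Y} := fun y => all (fun x => g x y == 0) l.
have cof_ker l : cof (ker l).
  elim: l => [|x l IH]; first exact: cof_setT.
  exact: cof_kernel (hg x) IH.
(* The choice [eps = 1] gives equivalence constant 2; a full branch has [k + 1] nodes, of lengths 0
   to [k]. *)
have [sigma hsigma] := cof_game_strategy (Yasym k.+1 (ltr01 : 0 < 1 :> K)).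
(* The list [l] holds the vectors of all smaller codes; nodes longer than [k] get the vector 0,
   which lies in every kernel. *)
pose F (l : seq Y) := let s := CodeSeq.decode (size l) in
  if (size s <= k)%N then
    sigma (branch (fun s' => ker (take (CodeSeq.code s') l)) s)
  else 0.
have [x hx] := strong_rec F.
pose X s := x (CodeSeq.code s).
pose W s := ker (mkseq x (CodeSeq.code s)).
have XE s : X s = if (size s <= k)%N then sigma (branch W s) else 0.
  rewrite /X hx /F size_mkseq CodeSeq.codeK; case: ifP => // _.
  congr sigma; apply: eq_branch => s' ss'; rewrite /W; congr ker.
  by rewrite -map_take take_iota (minn_idPl ss').
have full s : size s = k -> exists2 t : k.+1.-tuple Y,
    equivalent_families (1 + 1) (tnth t) (@linf_basis K k.+1) &
    forall j, (j < k.+1)%N -> [/\ nth 0 t j = X (drop (k - j) s),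
      X (drop (k - j) s) \in W (drop (k - j) s) & `|X (drop (k - j) s)| = 1].
  move=> sk; have [||t ht h] := hsigma (branch W s).
  - by rewrite size_branch sk.
  - by move=> i ik; rewrite nth_branch ?sk//; exact: cof_ker.
  exists t => // j jk; have [h1 h2 h3] := h j jk.
  have h4 : nth 0 t j = X (drop (k - j) s).
    by rewrite h1 take_branch sk// XE size_drop sk leq_subr.
  by rewrite -h4; split=> //; move: h2; rewrite nth_branch sk.
(* A shorter node is completed by zeros to a full branch. *)
have node s : (size s <= k)%N -> X s \in W s /\ `|X s| = 1.
  move=> sk; have := full (nseq (k - size s) 0%N ++ s).
  rewrite size_cat size_nseq subnK// => /(_ erefl)[t _ /(_ (size s))].
  by rewrite ltnS sk drop_size_cat ?size_nseq// => /(_ isT)[].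
have gL s c y z := let: And3 h _ _ := hg (X s) in h c y z.
have g0 s : g (X s) 0 = 0.
  by have := gL s (-1) 0 0; rewrite scaler0 addr0 mulN1r addNr.
apply: (@distortion_diamond _ _ _ N0 ND NN NM X (fun s => [set y | g (X s) y = 0]) k) => //.
- move=> s y z /= gy gz; rewrite addrC -scaleN1r gL gy gz mulr0 addr0 //.
- move=> s s' ss' /=; have [s'k|s'k] := boolP (size s' <= k)%N; last first.
    by rewrite [X s']XE (negbTE s'k).
  have [/allP h _] := node s' s'k; apply/eqP; apply: h.
  by apply/mapP; exists (CodeSeq.code s); rewrite // mem_iota.
- move=> s n z sk gz; have [_ _ /(_ n z gz)] := hg (X s).
  have [_ xs1] := node s sk; rewrite {1}/rnorm xs1.
  by rewrite (_ : rho 1 = 1)//; apply: iota_inj; rewrite rhoK ?rmorph1.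
(* Induction on the number of missing levels: full branches use the equivalence with [linf_basis],
   and on a shorter one [w] is the mean of its two extensions. *)
- move=> s w sk; move kE : (k - size s)%N => d.
  elim: d s w sk kE => [|d IH] s w sk ks hw.
    have {ks}sk : size s = k by lia.
    have [t [a [b [a0 b0 ab ht]]] h] := full s sk.
    (* Compare the first vectors, both of norm 1; then [b <= a * b <= 2]. *)
    have a1 : 1 <= a.
      have := ht (fun j => (j == ord0)%:R).
      have pick (V : lmodType K) (v : 'I_k.+1 -> V) :
          \sum_(j < k.+1) (j == ord0)%:R *: v j = v ord0.
        rewrite (bigD1 ord0)//= big1 ?addr0 ?scale1r// => j /negbTE ->.
        by rewrite scale0r.
      rewrite !pick.
      rewrite linf_basis_norm mulr1 (tnth_nth 0) /=.
      have [-> _ ->] := h 0%N isT.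
      by move=> /andP[+ _]; rewrite invf_le1.
    have b2 : b <= 2.
      by apply: le_trans ab; rewrite ler_peMl// ltW.
    have [alpha al ->] := signed_sum_coef hw.
    rewrite -ler_iota iotaN rmorph_nat sk.
    have /andP[_] := ht (fun j => alpha j).
    rewrite (eq_bigr (fun j : 'I_k.+1 => alpha j *: X (drop (k - j) s))); last first.
      by move=> j _; rewrite (tnth_nth 0); have [-> _ _] := h j (ltn_ord j).
    move=> /le_trans; apply; apply: le_trans b2.
    rewrite ger_pMr//; exact: linf_norm_le1.
  have hD (u : Y) : (u = w + X (0%N :: s) \/ u = w - X (0%N :: s)) -> N u <= 2.
    by move=> hu; apply: (IH (0%N :: s)) => /=; [lia|lia|exists w].
  have h1 := hD _ (or_introl erefl); have h2 := hD _ (or_intror erefl).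
  have := ND (w + X (0%N :: s)) (w - X (0%N :: s)).
  rewrite addrACA subrr addr0 -mulr2n NM mulr2n; lra.
Qed.

End tree.

(** * Norming functionals for real and complex scalars *)

Lemma norming_bound (R : realType) (K : numFieldType) (iota : {rmorphism R -> K})
    (V : lmodType K) (p u : V -> R) :
  (forall x, p (- x) = p x) -> (forall y z, u (y + z) = u y + u z) ->
  (forall t z, u (iota t *: z) = t * u z) -> (forall z, u z <= p z) ->
  forall z, `|u z| <= p z.
Proof.
move=> pN uD uZ up z; rewrite ler_norml up andbT lerNl -pN.
by have := up (- z); rewrite -scaleN1r -(rmorphN1 iota) uZ mulN1r.
Qed.

Lemma ex_norming_real (R : realType) (Y : normedModType R) (x : Y) :
  exists g, norming (id : R -> R) x g.
Proof.
pose iota : {rmorphism R -> R} := idfun.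
have sN : sublinear iota (rnorm id (Y := Y)) by apply: norm_sublinear.
have [u [uD uZ up ux]] := norming_functional x sN.
exists u; split.
- by move=> c y z; rewrite uD -(uZ c).
- exists 1 => // y; rewrite mul1r.
  apply: (norming_bound _ uD uZ up) => z; by rewrite /rnorm normrN.
- move=> n z uz; rewrite -ux; apply: le_trans (up _).
  by rewrite uD uz addr0 -[x *+ n]scaler_nat (uZ n%:R) mulr_natl.
Qed.

Lemma complex_real_le (R : realType) : {mono (real_complex R) : x y / x <= y}.
Proof. by move=> x y; rewrite lecE /= eqxx. Qed.

Lemma complex_ReK (R : realType) (c : complex R) :
  0 <= c -> real_complex R (complex.Re c) = c.
Proof. by case: c => a b; rewrite lecE /= => /andP[/eqP -> _]. Qed.

(* [y |-> u y - i u (i y)] is complex linear when [u] is real linear. *)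
Lemma ex_norming_complex (R : realType) (Y : normedModType (complex R)) (x : Y) :
  exists g, norming (@complex.Re R) x g.
Proof.
pose iota : {rmorphism R -> complex R} := real_complex R.
have sN : sublinear iota (rnorm (@complex.Re R) (Y := Y)).
  by apply: norm_sublinear; [exact: complex_ReK|exact: complex_real_le].
have [u [uD uZ up ux]] := norming_functional x sN.
pose j : complex R := Complex 0 1.
have ub : forall z, `|u z| <= rnorm (@complex.Re R) z.
  by apply: (norming_bound _ uD uZ up) => z; rewrite /rnorm normrN.
have uN z : u (- z) = - u z.
  by rewrite -scaleN1r -(rmorphN1 iota) uZ mulN1r.
have jn z : rnorm (@complex.Re R) (j *: z) = rnorm (@complex.Re R) z.
  rewrite /rnorm normrZ (_ : `|j| = 1) ?mul1r//.
  by rewrite normc_def /= expr0n /= add0r expr1n sqrtr1.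
exists (fun y => Complex (u y) (- u (j *: y))); split.
- move=> [a b] y z.
  have cE (v : Y) : Complex a b *: v = iota a *: v + iota b *: (j *: v).
    rewrite scalerA -scalerDl; congr (_ *: _).
    by apply/eqP; rewrite eq_complex; apply/andP; split; apply/eqP => /=; ring.
  have jj (v : Y) : j *: (j *: v) = - v.
    rewrite scalerA -scaleN1r; congr (_ *: _).
    by apply/eqP; rewrite eq_complex; apply/andP; split; apply/eqP => /=; ring.
  rewrite scalerDr scalerA mulrC -scalerA (cE y) (cE (j *: y)) jj !uD !uZ uN.
  by apply/eqP; rewrite eq_complex /=; apply/andP; split; apply/eqP; ring.
(* The real and imaginary parts are each at most the norm of [y], as multiplication by [j] is
   isometric. *)
- exists 2 => // y.
  have -> : Complex (u y) (- u (j *: y)) = iota (u y) - j * iota (u (j *: y)).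
    by apply/eqP; rewrite eq_complex; apply/andP; split; apply/eqP => /=; ring.
  apply: le_trans (ler_normB _ _) _.
  have rn (r : R) : `|iota r| = iota `|r|.
    by rewrite normc_def /= expr0n /= addr0 sqrtr_sqr.
  rewrite normrM !rn (_ : `|j| = 1) ?mul1r; last first.
    by rewrite normc_def /= expr0n /= add0r expr1n sqrtr1.
  rewrite mulr_natl mulr2n -[`|y|]complex_ReK//.
  apply: lerD; rewrite complex_real_le; first exact: ub.
  by apply: le_trans (ub _) _; rewrite jn.
(* The real part [u] of the functional vanishes at [z] and already gives the lower bound. *)
- move=> n z [uz _]; rewrite -ux; apply: le_trans (up _).
  by rewrite uD uz addr0 -[x *+ n]scaler_nat -(rmorph_nat iota) uZ mulr_natl.
Qed.

(* The two conjuncts are the cases of real and of complex scalars. *)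
Theorem theorem1 (R : realType) :
  (forall Y : completeNormedModType R,
    (forall n : nat, asymptotic_structure Y (@linf_basis R n)) ->
    (ereal_sup [set distortion (graph_dist R (diamond k))
                      (fun x y : Y => `|x - y|%R) | k in [set: nat]] < +oo)%E)
  /\
  (forall Y : completeNormedModType (complex R),
    (forall n : nat, asymptotic_structure Y (@linf_basis (complex R) n)) ->
    (ereal_sup [set distortion (graph_dist R (diamond k))
                      (fun x y : Y => complex.Re `|x - y|%R) | k in [set: nat]]
      < +oo)%E).
Proof.
(* The bound 14 is uniform in [k]. *)
split=> Y Yasym; apply: (@le_lt_trans _ _ 14%:E); rewrite ?ltry//;
  apply: ge_ereal_sup => _ [k _ <-].
- exact: (@distortion_diamond_le _ _ (idfun : {rmorphism R -> R}) id _ _ Y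
    (@ex_norming_real R Y) Yasym k).
- exact: (@distortion_diamond_le _ _ (real_complex R : {rmorphism R -> complex R})
    (@complex.Re R) (@complex_ReK R) (@complex_real_le R) Y
    (@ex_norming_complex R Y) Yasym k).
Qed.
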